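(* Let $(M,d)$ be a (nonempty) metric tree and let $A\subseteq M$ be any subset. Then $$\lim_{n\to\infty}\delta_n^T(A,M)=a(A,M),$$ where $\delta_n^T(A,M)$ is the T$n$-width of $A$ and $a(A,M)$ is the compact width of $A$ (with the convention that if $M$ is T*$k$-dimensional then $\delta_n^T(A,M)=\delta_k^T(A,M)$ for $n>k$).
   Context: Metric segment: in a metric space $(M,d)$, a metric segment from $x$ to $y$ is the image of an isometric embedding $\alpha:[a,b]\to M$ of a real interval with $\alpha(a)=x$ and $\alpha(b)=y$; it is denoted $[x,y]$. Metric tree: a metric space $(M,d)$ is a metric tree if for all $x,y,z\in M$: (1) there exists a unique metric segment $[x,y]$ from $x$ to $y$; and (2) if $[x,z]\cap[z,y]=\{z\}$ then $[x,z]\cup[z,y]=[x,y]$. Betweenness: $xzy$ means $d(x,y)=d(x,z)+d(z,y)$, i.e. $z$ is between $x$ and $y$. Convexity: a subset $A$ of a metric tree $M$ is convex if $[x,y]\subseteq A$ for all $x,y\in A$. The convex hull $\mathrm{conv}(B)$ of $B\subseteq M$ is the smallest convex subset of $M$ containing $B$. T$n$-dimensional sets: for a positive integer $n$, a subset $A\subseteq M$ is T$n$-dimensional if there exist $n$ distinct points $x_1,\dots,x_n\in M$ with $A=\mathrm{conv}(x_1,\dots,x_n)$ and such that there are no pairwise distinct indices $i,j,k$ with $x_ix_jx_k$ (no point lies between two others). A set $A$ is T*$n$-dimensional if it contains a T$n$-dimensional subset but contains no T$k$-dimensional subset for any $k>n$. T$n$-width: let $\mathcal{X}_n$ be the set of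 T$n$-dimensional subsets of $M$. For $A\subseteq M$ and a positive integer $n$, $$\delta_n^T(A,M)=\inf_{X\in\mathcal{X}_n}\,\sup_{a\in A}\,\inf_{x\in X} d(a,x)\in[0,\infty].$$ If $M$ is T*$n$-dimensional, then by convention $\delta_k^T(A,M)=\delta_n^T(A,M)$ for all $k>n$. Compact width: with $\mathcal{X}$ the set of compact subsets of $M$, $$a(A,M)=\inf_{X\in\mathcal{X}}\,\sup_{a\in A}\,\inf_{x\in X} d(a,x)\in[0,\infty].$$ *)

(* Defs.v *)
From mathcomp Require Import all_boot all_order all_algebra.
From mathcomp Require Import all_classical all_reals all_analysis.

Set Implicit Arguments.
Unset Strict Implicit.
Unset Printing Implicit Defensive.

Import Order.TTheory GRing.Theory Num.Theory.

Local Open Scope classical_set_scope.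
Local Open Scope ring_scope.

Section metric_trees.
Context {R : realType} {M : metricType R}.
Implicit Types (x y z : M) (A B X S : set M) (n : nat).

(* Only the values of alpha on [a, b] matter. *)
Definition metric_segment x y S : Prop :=
  exists (a b : R) (alpha : R -> M),
    [/\ a <= b,
        {in `[a, b] &, forall s t, mdist (alpha s) (alpha t) = `|s - t|},
        alpha a = x, alpha b = y & S = alpha @` `[a, b]].

Definition between x z y : Prop := mdist x y = mdist x z + mdist z y.

Definition convex_subset A : Prop :=
  forall x y S, A x -> A y -> metric_segment x y S -> S `<=` A.

Definition metric_hull B : set M := smallest convex_subset B.

Definition Tdim n A : Prop :=
  (0 < n)%N /\
  exists x : 'I_n -> M,
    [/\ injective x,
        A = metric_hull (range x) &
        ~ exists i j k : 'I_n,
            [/\ i != j, j != k, i != k & between (x i) (x j) (x k)]].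

Definition Tstar_dim n A : Prop :=
  [/\ (0 < n)%N,
      exists2 X, Tdim n X & X `<=` A &
      forall k X, (n < k)%N -> Tdim k X -> ~ X `<=` A].

(* The supremum is taken in [0, +oo], so it is 0 when A is empty, whereas
   ereal_sup set0 = -oo; hence the maximum with 0. *)
Definition deviation A X : \bar R :=
  maxe 0%E (ereal_sup [set ereal_inf [set (mdist a x)%:E | x in X] | a in A]).

Definition width_by (F : set (set M)) A : \bar R :=
  ereal_inf [set deviation A X | X in F].

(* If the whole space is T*k-dimensional for some (necessarily unique) k < n,
   the n-th width is by convention the k-th one; otherwise xget returns its
   default n. The index n = 0 carries no meaning. *)
Definition Twidth n A : \bar R :=
  width_by (Tdim (xget n [set k | (k < n)%N /\ Tstar_dim k [set: M]])) A.

Definition compact_width A : \bar R := width_by [set X | compact X] A.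

End metric_trees.

Definition metric_tree (R : realType) (M : metricType R) : Prop :=
  (forall x y : M, exists! S : set M, metric_segment x y S) /\
  (forall (x y z : M) (Sxz Szy Sxy : set M),
     metric_segment x z Sxz -> metric_segment z y Szy ->
     metric_segment x y Sxy ->
     Sxz `&` Szy = [set z] -> Sxz `|` Szy = Sxy).

(* Main.v *)
(* In a metric tree [x, y] is the set of points between x and y, and triangles
   are thin: [x, y] is contained in [x, z] `|` [z, y].  Hence the hull of
   x_1, ..., x_n is the union of the segments [x_1, x_i]; it is compact, so
   a(A, M) is at most every T n-width.  Conversely, a compact set has a finite
   e-net; dropping points that lie between two others gives a T m-dimensional
   set that does at least as well up to e.  Finally a T m-dimensional set is
   contained in a T n-dimensional one for every n >= m such that the latter
   exist: span everything by a between-free family t, choose for each of the m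
   points x a point e(x) of t beyond x, and add n - m further points of t. *)
Require Import Defs.
From mathcomp Require Import all_boot all_order all_algebra.
From mathcomp Require Import all_classical all_reals all_analysis.
From mathcomp Require Import lra.

Set Implicit Arguments.
Unset Strict Implicit.
Unset Printing Implicit Defensive.

Import Order.TTheory GRing.Theory Num.Theory.
Import numFieldNormedType.Exports.

Local Open Scope classical_set_scope.
Local Open Scope ring_scope.

(** * Duplicate-free sequences *)

Lemma uniq_neq_exists (T : eqType) (x : T) (s : seq T) :
  uniq s -> (1 < size s)%N -> exists2 y, y \in s & y != x.
Proof.
case: s => [|y [|z s]]//= /andP[]; rewrite inE => /norP[yz _] _ _.
have [yx|yx] := eqVneq y x; last by exists y; rewrite // mem_head.
by exists z; rewrite ?inE ?eqxx ?orbT// -yx eq_sym.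
Qed.

Lemma seq_interpolate (T : eqType) (s t : seq T) n :
    uniq s -> uniq t -> {subset s <= t} -> (size s <= n <= size t)%N ->
  exists u, [/\ uniq u, {subset s <= u}, {subset u <= t} & size u = n].
Proof.
move=> us ut st /andP[sn nt]; pose r := [seq x <- t | x \notin s].
have tr : size t = (size s + size r)%N.
  rewrite -size_cat; apply/perm_size/uniq_perm => //.
    rewrite cat_uniq us filter_uniq// andbT -all_predC.
    by apply/allP => x; rewrite mem_filter => /andP[].
  move=> x; rewrite mem_cat mem_filter.
  by case: (boolP (x \in s)) => //= /st.
exists (s ++ take (n - size s) r); split.
- rewrite cat_uniq us take_uniq ?filter_uniq// andbT -all_predC.
  by apply/allP => x /mem_take; rewrite mem_filter => /andP[].
- by move=> x xs; rewrite mem_cat xs.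
- move=> x; rewrite mem_cat => /orP[/st//|/mem_take].
  by rewrite mem_filter => /andP[].
- by rewrite size_cat size_takel ?subnKC// leq_subLR -tr.
Qed.

(** * Betweenness and segments in an arbitrary metric space *)

Section metric_space.
Context {R : realType} {M : metricType R}.
Implicit Types (x y z w : M) (A B S X Y : set M) (s t : seq M).

Lemma between_sym x z y : between x z y -> between y z x.
Proof.
by rewrite /between (metric_sym y x) (metric_sym y z) (metric_sym z x) addrC.
Qed.

Lemma between_left x y : between x x y.
Proof. by rewrite /between mdistxx add0r. Qed.

Lemma between_right x y : between x y y.
Proof. by rewrite /between mdistxx addr0. Qed.

Lemma between_trans x z y w : between x z y -> between x w z -> between x w y.
Proof.
rewrite /between => xzy xwz.
have := metric_triangle x w y; have := metric_triangle w z y; lra.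
Qed.

Lemma mdist_le0 x y : mdist x y <= 0 -> x = y.
Proof.
by move=> xy; apply: mdist_positivity; apply/le_anti; rewrite xy mdist_ge0.
Qed.

Lemma between_eq x z y : between x z y -> between x y z -> y = z.
Proof.
move=> xzy xyz; apply: mdist_le0; move: xzy xyz.
rewrite /between (metric_sym z); have := mdist_ge0 y z; lra.
Qed.

(** Otherwise the path from [x] to [y] through [w] would be shorter than [mdist x y] by twice
    [mdist w z]. *)
Lemma between_split x z y w :
  between x z y -> between x w z -> between z w y -> w = z.
Proof.
move=> xzy xwz zwy; apply: mdist_le0; move: xzy xwz zwy.
rewrite /between (metric_sym z w).
have := metric_triangle x w y; have := mdist_ge0 w z; lra.
Qed.

Lemma metric_segment_sub_between x y S :
  metric_segment x y S -> S `<=` between x ^~ y.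
Proof.
move=> [a [b [f [ab fiso <- <- ->]]]] _ [t tab <-]; rewrite /between.
have [aab bab] : a \in `[a, b] /\ b \in `[a, b] by rewrite !in_itv/= ab !lexx.
have /andP[at_ tb] : a <= t <= b by move: tab; rewrite /= in_itv.
rewrite !fiso// !ler0_norm; lra.
Qed.

Lemma metric_segment_ends x y S : metric_segment x y S -> S x /\ S y.
Proof.
move=> [a [b [f [ab fiso <- <- ->]]]].
by split; [exists a | exists b] => //=; rewrite in_itv/= ab lexx.
Qed.

Lemma metric_segment_compact x y S : metric_segment x y S -> compact S.
Proof.
move=> [a [b [f [ab fiso _ _ ->]]]].
refine (@continuous_compact _ _ _ _ _ (@segment_compact R a b)).
apply/subspace_continuousP => t /= tab.
apply/metricType_numDomainType.cvgrPdist_lt => e e0.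
near=> u.
have uab : u \in `[a, b] by near: u; exact: withinT.
rewrite fiso//; by near: u; apply: cvgr_dist_lt e0; exact: cvg_within.
Unshelve. all: by end_near. Qed.

Lemma continuous_mdist x : continuous (mdist x : M -> R).
Proof.
move=> y; apply/cvgrPdist_lt => e e0; near=> z.
have : mdist y z < e by near: z; exact: metricType_numDomainType.cvgr_dist_lt.
apply: le_lt_trans; rewrite ler_norml.
have := metric_triangle x y z; have := metric_triangle x z y.
rewrite (metric_sym z y); lra.
Unshelve. all: by end_near. Qed.

(** * Hulls and between-free families *)

Lemma metric_hull_convex B : convex_subset (metric_hull B).
Proof.
move=> x y S Bx By xyS w Sw C [cC BC].
by apply: (cC x y S) => //; [exact: Bx|exact: By].
Qed.

(** The condition in [Tdim], stated for sequences instead of families over ['I_n] so that points are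
    easily dropped or appended. *)
Definition between_free s : Prop :=
  uniq s /\ forall x y z, x \in s -> y \in s -> z \in s ->
    x != y -> y != z -> x != z -> ~ between x y z.

Lemma between_free_sub s t :
  uniq t -> {subset t <= s} -> between_free s -> between_free t.
Proof.
move=> ut ts [_ bs]; split=> // x y z /ts xs /ts ys /ts; exact: bs.
Qed.

Lemma TdimP n A : Tdim n A <-> exists s,
  [/\ (0 < n)%N, size s = n, between_free s & A = metric_hull [set` s]].
Proof.
split=> [[n0 [x [xinj -> bx]]]|[s [n0 sn [us bs] ->]]].
  exists (codom x); split=> //; first by rewrite size_codom card_ord.
    split=> [|_ _ _ /codomP[i ->] /codomP[j ->] /codomP[k ->] ij jk ik b].
      by rewrite map_inj_uniq ?enum_uniq.
    by apply: bx; exists i, j, k; split=> //;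
      [move: ij|move: jk|move: ik]; apply: contra => /eqP ->.
  congr metric_hull; apply/seteqP; split=> [_ [i _ <-]|_ /codomP[i ->]].
    exact: codom_f.
  by exists i.
split=> //; rewrite -sn; exists (tnth (in_tuple s)); split.
- exact/tuple_uniqP.
- congr metric_hull; apply/seteqP.
  split=> [x /= /(@tnthP _ _ (in_tuple s))[i ->]|].
    by exists i.
  by move=> _ [i _ <-]; exact: mem_tnth.
- have tI : injective (tnth (in_tuple s)) by exact/tuple_uniqP.
  move=> [i [j [k [ij jk ik]]]].
  by apply: bs; rewrite ?(inj_eq tI)//; exact: mem_tnth.
Qed.

(** * Deviations, widths and finite nets *)

Lemma deviation_ge0 A X : (0 <= deviation A X)%E.
Proof. by rewrite /deviation le_max lexx. Qed.

Lemma width_by_ge0 (F : set (set M)) A : (0 <= width_by F A)%E.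
Proof. by apply: le_ereal_inf_tmp => _ [X _ <-]; exact: deviation_ge0. Qed.

Lemma deviation_le_near A X Y (e : R) : 0 <= e ->
    (forall x, X x -> exists2 y, Y y & mdist x y <= e) ->
  (deviation A Y <= deviation A X + e%:E)%E.
Proof.
move=> e0 XY; rewrite [leLHS]/deviation ge_max.
rewrite adde_ge0 ?deviation_ge0 ?lee_fin//=.
apply: ge_ereal_sup => _ [a Aa <-].
apply: (@le_trans _ _ (ereal_inf [set (mdist a x)%:E | x in X] + e%:E)%E); last first.
  rewrite leeD2r// /deviation le_max; apply/orP; right.
  by apply: ereal_sup_ubound; exists a.
rewrite -leeBlDr//; apply: le_ereal_inf_tmp => _ [x Xx <-].
have [y Yy xye] := XY _ Xx.
rewrite leeBlDr// -EFinD; apply: (@le_trans _ _ (mdist a y)%:E).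
  by apply: ereal_inf_lbound; exists y.
by rewrite lee_fin (le_trans (metric_triangle a x y))// lerD2l.
Qed.

Lemma compact_finite_net X (e : R) : compact X -> 0 < e ->
  exists s, forall x, X x -> exists2 y, y \in s & mdist x y <= e.
Proof.
move=> /compact_near_coveringP cX e0.
(* Finite sequences directed by inclusion: every sequence containing [x] is [e]-close to all points
   near [x], and near-covering then yields one sequence for all of [X]. *)
pose F : set_system (seq M) :=
  filter_from setT (fun s => [set t | {subset s <= t}]).
have FF : ProperFilter F.
  apply: filter_from_proper => [|s _]; last by exists s.
  apply: filter_from_filter; first by exists [::].
  move=> s t _ _; exists (s ++ t) => // u /= stu.
  by split=> x xs; apply: stu; rewrite mem_cat xs ?orbT.
have /filter_ex[s sX] : \forall s \near F,
    X `<=` [set x | exists2 y, y \in s & mdist x y <= e].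
  apply: (cX _ F (fun s x => exists2 y, y \in s & mdist x y <= e)) => x Xx.
  exists (ball x e, [set t | {subset [:: x] <= t}]) => /=.
    by split; [exact: nbhsx_ballx|exists [:: x]].
  move=> [y t] [/=]; rewrite ballEmdist /= => xy xt.
  by exists x; [apply: xt; rewrite mem_head|rewrite metric_sym ltW].
by exists s.
Qed.

End metric_space.

(** * Segments and thin triangles in a metric tree *)

Section tree.
Context {R : realType} {M : metricType R}.
Hypothesis M_tree : metric_tree M.
Implicit Types (x y z w : M) (A B S X Y : set M) (s t : seq M).

Lemma metric_segment_exists x y : exists S, metric_segment x y S.
Proof. by have [S [xyS _]] := M_tree.1 x y; exists S. Qed.

(** If [w] is between [x] and [y], then [[x, w]] and [[w, y]] meet only in [w], so by the second
    tree axiom their union is [[x, y]]. *)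
Lemma metric_segment_between x y S :
  metric_segment x y S -> S = between x ^~ y.
Proof.
move=> xyS; apply/seteqP; split; first exact: metric_segment_sub_between.
move=> w xwy.
have [Sl xwSl] := metric_segment_exists x w.
have [Sr wySr] := metric_segment_exists w y.
have [_ Slw] := metric_segment_ends xwSl; have [Srw _] := metric_segment_ends wySr.
rewrite -(M_tree.2 _ _ _ _ _ _ xwSl wySr xyS); first by left.
apply/seteqP; split=> [q []|_ ->]; last by split.
move=> /(metric_segment_sub_between xwSl) xqw.
by move=> /(metric_segment_sub_between wySr); exact: between_split xwy xqw.
Qed.

Lemma between_segment x y : metric_segment x y (between x ^~ y).
Proof.
by have [S xyS] := metric_segment_exists x y; rewrite -(metric_segment_between xyS).
Qed.

Lemma between_compact x y : compact (between x ^~ y).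
Proof. exact: metric_segment_compact (between_segment x y). Qed.

Lemma convex_subsetP A :
  convex_subset A <-> forall x y w, A x -> A y -> between x w y -> A w.
Proof.
split=> [cA x y w Ax Ay|cA x y S Ax Ay xyS w].
  exact: (cA x y _ Ax Ay (between_segment x y)).
by rewrite (metric_segment_between xyS); exact: cA.
Qed.

(* Triangles are tripods: split [x, y] at the point of [x, z] `&` [z, y]
   closest to x. *)
Lemma between_thin x y z w : between x w y -> between x w z \/ between z w y.
Proof.
have [p] : exists2 p, p \in between x ^~ z `&` between z ^~ y &
    forall q, q \in between x ^~ z `&` between z ^~ y -> mdist x p <= mdist x q.
  apply: compact_EVT_min.
  - by exists z; split; [exact: between_right|exact: between_left].
  - apply: compact_closedI; first exact: between_compact.
    by apply: compact_closed; [exact: metric_hausdorff|exact: between_compact].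
  - apply: continuous_subspaceT; exact: continuous_mdist.
rewrite inE => -[xpz zpy] pmin.
rewrite -[between x w y]/((between x ^~ y) w).
rewrite -(M_tree.2 _ _ _ _ _ _ (between_segment x p) (between_segment p y)
  (between_segment x y)); last first.
  (* A common point [q] of [[x, p]] and [[p, y]] also lies on [[x, z]] and [[z, y]], so it is no
     closer to [x] than [p]; hence [q = p]. *)
  apply/seteqP; split=> [q [/= xqp pqy]|_ ->]; last first.
    by split; [exact: between_right|exact: between_left].
  have := pmin q; rewrite inE => /(_ _); move: (xqp); rewrite {1}/between => ->.
  rewrite gerDl metric_sym => h; apply/esym/mdist_le0/h; split.
    exact: between_trans xpz xqp.
  exact/between_sym/(between_trans (between_sym zpy))/between_sym.
case=> /= [xwp|pwy]; [left|right].
  exact: between_trans xpz xwp.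
exact/between_sym/(between_trans (between_sym zpy))/between_sym.
Qed.

(** * Hulls of finite sets *)

Lemma metric_hull_between B x y w :
  metric_hull B x -> metric_hull B y -> between x w y -> metric_hull B w.
Proof. by have /convex_subsetP := @metric_hull_convex R M B; exact. Qed.

(** The star of segments issuing from [x] is convex: by thinness, a point between two of its points
    is between [x] and one of them. *)
Lemma metric_hull_cons x s :
  metric_hull [set` x :: s] = \bigcup_(y in [set` x :: s]) (between x ^~ y).
Proof.
apply/seteqP; split.
  apply: smallest_sub => [|y ys]; last by exists y; [|exact: between_right].
  apply/convex_subsetP => u v w [y ys xuy] [z zs xvz] uwv.
  have [uwx|xwv] := between_thin x uwv.
    exists y => //; exact: between_trans xuy (between_sym uwx).
  exists z => //; exact: between_trans xvz xwv.
move=> w [y ys]; apply: metric_hull_between; apply: sub_gen_smallest => //.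
by rewrite /= mem_head.
Qed.

Lemma metric_hull_seq_compact s : compact (metric_hull [set` s]).
Proof.
case: s => [|x s]; last first.
  rewrite metric_hull_cons bigcup_seq.
  by apply: bigsetU_compact => y _; exact: between_compact.
suff -> : metric_hull [set` [::]] = set0 :> set M by exact: compact0.
by rewrite -subset0; apply: smallest_sub => // x y S [].
Qed.

Lemma metric_hull_seq_nil w s : metric_hull [set` s] w -> s != [::].
Proof.
case: s => // h; have : (set0 : set M) w by apply: h; split => // x y S [].
by [].
Qed.

(** * Spanning and counting with between-free families *)

(** Dropping a repetition, or a point between two others, does not shrink the hull; induction on the
    length. *)
Lemma between_free_span s : exists t,
  [/\ between_free t, {subset t <= s} & [set` s] `<=` metric_hull [set` t]].
Proof.
have [n] := ubnP (size s); elim: n s => // n IHn s; rewrite ltnS => sn.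
have [us|nus] := boolP (uniq s); last first.
  have [|t [bt tu ut]] := IHn (undup s).
    by rewrite (leq_trans _ sn)// ltn_size_undup.
  exists t; split=> // x; first by move/tu; rewrite mem_undup.
  by move=> xs; apply: ut; rewrite /= mem_undup.
have [bs|] := pselect (forall x y z, x \in s -> y \in s -> z \in s ->
    x != y -> y != z -> x != z -> ~ between x y z).
  by exists s; split=> //; exact: sub_gen_smallest.
move=> /existsNP[x /existsNP[y /existsNP[z]]].
move=> /not_implyP[xs /not_implyP[ys /not_implyP[zs]]].
move=> /not_implyP[xy /not_implyP[yz /not_implyP[_ /contrapT xyz]]].
have [|t [bt ts st]] := IHn (rem y s).
  by rewrite size_rem// (leq_trans _ sn)// ltn_predL; case: (s) ys.
exists t; split=> // [w /ts /mem_rem//|w ws].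
have [->|wy] := eqVneq w y.
  by apply: metric_hull_between xyz; apply: st; rewrite /= mem_rem_uniq// inE
    ?xy// eq_sym yz.
by apply: st; rewrite /= mem_rem_uniq// inE wy.
Qed.

(* The points that x does not separate from y form a convex set. *)
Lemma between_free_beyond s t x y : between_free s ->
    [set` s] `<=` metric_hull [set` t] -> x \in s -> y \in s -> y != x ->
  exists2 e, e \in t & forall z, z \in s -> z != x -> between z x e.
Proof.
move=> [_ bs] st xs ys yx.
(* Otherwise [C] would be a convex set containing [t], hence its hull, but not [x]. *)
have [e et yxe] : exists2 e, e \in t & between y x e.
  apply: contrapT => nbt; pose C := [set z | ~ between y x z].
  suff tC : metric_hull [set` t] `<=` C.
    exact: (tC _ (st _ xs) (between_right y x)).
  apply: smallest_sub => [|z zt yxz]; last by apply: nbt; exists z.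
  apply/convex_subsetP => u v w nu nv uwv yxw.
  have [//|uxw] := between_thin u yxw.
  have [//|vxw] := between_thin v yxw.
  have xw : x = w.
    apply: (between_split uwv) => //; exact: between_sym.
  move: uwv; rewrite -xw => /(between_thin y)[/between_sym|] //.
(* The same [e] serves every [z]: thinness leaves only [x] between [y] and [z] as an alternative,
   which [bs] excludes. *)
exists e => // z zs zx; have [<-//|zy] := eqVneq y z.
have [yxz|//] := between_thin z yxe.
by case: (bs y x z); rewrite // 1?eq_sym.
Qed.

Lemma between_free_beyond_fun s t : between_free s -> (1 < size s)%N ->
    [set` s] `<=` metric_hull [set` t] ->
  exists2 e : M -> M, {in s, forall x, e x \in t} &
    {in s &, forall x y, y != x -> between y x (e x)}.
Proof.
move=> bs s1 st.
have /choice[e eP] x : exists e, x \in s ->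
    e \in t /\ forall z, z \in s -> z != x -> between z x e.
  have [xs|] := boolP (x \in s); last by exists x.
  have [y ys yx] := uniq_neq_exists x bs.1 s1.
  by have [e et eb] := between_free_beyond bs st xs ys yx; exists e.
by exists e => [x /eP[]//|x y /eP[_ +] ys]; exact.
Qed.

(** Sending [x] to a point of [t] beyond it is injective: if [x] and [y] had the same image, each
    would lie between the other and that image. *)
Lemma between_free_size s t : between_free s ->
  [set` s] `<=` metric_hull [set` t] -> (size s <= size t)%N.
Proof.
move=> bs st; have [s1|] := ltnP 1 (size s); last first.
  case: s st {bs} => // x s st /leq_trans; apply.
  by rewrite lt0n size_eq0; exact: metric_hull_seq_nil (st x (mem_head _ _)).
have [e et eb] := between_free_beyond_fun bs s1 st.
rewrite -(size_map e); apply: uniq_leq_size => [|_ /mapP[x xs ->]]; last exact: et.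
rewrite map_inj_in_uniq; first exact: bs.1.
move=> x y xs ys exy; apply/eqP/contraT => xy.
have yx : y != x by rewrite eq_sym.
rewrite -(negbTE xy); apply/eqP.
have := eb _ _ xs ys yx; have := eb _ _ ys xs xy.
by rewrite exy => /between_sym b1 /between_sym b2; exact: between_eq b1 b2.
Qed.

(* The points e x beyond the x in s span s; the bound is 2 when s is a
   singleton, whose point may be interior to a segment. *)
Lemma between_free_small_span s t : between_free s -> (0 < size s)%N ->
    [set` s] `<=` metric_hull [set` t] ->
  exists u, [/\ uniq u, {subset u <= t}, (size u <= maxn 2 (size s))%N &
    [set` s] `<=` metric_hull [set` u]].
Proof.
move=> bs s0 st; have [s1|s1] := ltnP 1 (size s).
  have [e et eb] := between_free_beyond_fun bs s1 st.
  exists (undup (map e s)); split.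
  - exact: undup_uniq.
  - by move=> _ /[!mem_undup] /mapP[x xs ->]; exact: et.
  - by rewrite leq_max -(size_map e s) size_undup orbT.
  move=> x xs; have [y ys yx] := uniq_neq_exists x bs.1 s1.
  have xy : x != y by rewrite eq_sym.
  have hull_e z : z \in s -> metric_hull [set` undup (map e s)] (e z).
    by move=> zs; apply: sub_gen_smallest; rewrite /= mem_undup map_f.
  apply: metric_hull_between (hull_e _ ys) (hull_e _ xs) _.
  (* If [x] were not between [e y] and [e x], it would be between [y] and [e y]; as [y] is between
     [x] and [e y], this forces [x = y]. *)
  have [yxey|//] := between_thin (e y) (eb x y xs ys yx).
  have /between_sym xyey := eb y x ys xs xy.
  by rewrite (between_eq xyey (between_sym yxey)) eqxx in xy.
case: s s0 s1 {bs} st => // x [|//] _ _ st.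
case: t st => [|a t] st.
  by have /metric_hull_seq_nil := st x (mem_head _ _).
have := st x (mem_head _ _); rewrite metric_hull_cons => -[y yt axy].
exists (undup [:: a; y]); split.
- exact: undup_uniq.
- move=> z; rewrite mem_undup !inE => /orP[/eqP->|/eqP->//]; exact: mem_head.
- by rewrite leq_max (leq_trans (size_undup _)).
have hull_u z : z \in [:: a; y] -> metric_hull [set` undup [:: a; y]] z.
  by rewrite -mem_undup => zu; apply: sub_gen_smallest.
move=> _ /= /[1!inE] /eqP ->.
by apply: metric_hull_between axy; apply: hull_u; rewrite !inE eqxx ?orbT.
Qed.

(** As [t] may not span [s], a between-free [r] spanning both replaces it and has at least as many
    points. A small part of [r] spanning [s] is then padded within [r]. *)
Lemma between_free_extend s t n : between_free s -> between_free t ->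
    (0 < size s)%N -> (size s <= n <= size t)%N ->
  exists u, [/\ between_free u, size u = n &
    [set` s] `<=` metric_hull [set` u]].
Proof.
move=> bs bt s0 /andP[+ nt].
(* Once [size s = n] is settled, [n] is at least 2, so [maxn 2 (size s)] does not exceed it. *)
rewrite leq_eqVlt => /predU1P[<-|sn].
  by exists s; split=> //; exact: sub_gen_smallest.
have [r [br _ str]] := between_free_span (s ++ t).
have tr : (size t <= size r)%N.
  by apply: between_free_size => // x xt; apply: str; rewrite /= mem_cat xt orbT.
have sr : [set` s] `<=` metric_hull [set` r].
  by move=> x xs; apply: str; rewrite /= mem_cat xs.
have [u [uu ur us su]] := between_free_small_span bs s0 sr.
have [|v [uv sv vr vn]] := @seq_interpolate _ u r n uu br.1 ur.
  rewrite (leq_trans nt tr) andbT (leq_trans us)// geq_max (ltnW sn) andbT.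
  exact: leq_ltn_trans s0 sn.
exists v; split=> //; first exact: between_free_sub br.
apply: subset_trans su _; apply: smallest_sub; first exact: metric_hull_convex.
by move=> x /sv xv; apply: sub_gen_smallest.
Qed.

(** * T-dimensional sets: enlargement, compactness, approximation *)

Lemma Tdim_extend m n A X : Tdim m A -> Tdim n X -> (m <= n)%N ->
  exists2 Y, Tdim n Y & A `<=` Y.
Proof.
move=> /TdimP[s [m0 sm bs ->]] /TdimP[t [n0 tn bt _]] mn.
have [||u [bu un su]] := between_free_extend bs bt (n := n).
- by rewrite sm.
- by rewrite sm mn tn /=.
exists (metric_hull [set` u]); first by apply/TdimP; exists u.
by apply: smallest_sub => //; exact: metric_hull_convex.
Qed.

Lemma Tdim_compact n X : Tdim n X -> compact X.
Proof. by move=> /TdimP[s [_ _ _ ->]]; exact: metric_hull_seq_compact. Qed.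

Lemma Tdim_le m n X : Tdim n X -> (0 < m <= n)%N -> exists Y, Tdim m Y.
Proof.
move=> /TdimP[s [n0 sn bs _]] /andP[m0 mn].
exists (metric_hull [set` take m s]); apply/TdimP; exists (take m s).
split=> //; first by rewrite size_takel// sn.
exact: between_free_sub (take_uniq _ bs.1) (fun x => @mem_take _ _ _ x) bs.
Qed.

Lemma compact_Tdim_approx X (e : R) : [set: M] !=set0 -> compact X -> 0 < e ->
  exists n, exists2 Y, Tdim n Y &
    forall x, X x -> exists2 y, Y y & mdist x y <= e.
Proof.
move=> [x0 _] cX e0; have [s sX] := compact_finite_net cX e0.
(* Adding [x0] keeps the family nonempty even when [X] is empty. *)
have [t [bt _ st]] := between_free_span (x0 :: s).
exists (size t), (metric_hull [set` t]).
  apply/TdimP; exists t; split=> //; rewrite lt0n size_eq0.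
  exact: metric_hull_seq_nil (st x0 (mem_head _ _)).
move=> x /sX[y ys xy]; exists y => //; apply: st.
by rewrite /= inE ys orbT.
Qed.

(** * Comparison of the two widths *)

Lemma Twidth_ge A n : (compact_width A <= Twidth n A)%E.
Proof.
by apply: ereal_inf_le_tmp => _ [X TX <-]; exists X => //; exact: Tdim_compact TX.
Qed.

(* k is the index at which Twidth n is actually evaluated. *)
Lemma Twidth_index n m X : Tdim m X -> (m <= n)%N ->
  let k := xget n [set k | (k < n)%N /\ Tstar_dim k [set: M]] in
  (m <= k)%N /\ exists Y, Tdim k Y.
Proof.
move=> TX mn k; rewrite /k; case: xgetP => [j _ [jn [j0 [Y TY _] jmax]]|nT].
  split; last by exists Y.
  by rewrite leqNgt; apply/negP => jm; exact: jmax jm TX _.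
(* Here the index is the default [n]. Were there no T[n]-dimensional set, the largest dimension [j]
   that occurs would be below [n], making the space T*[j]-dimensional. *)
split=> //; apply: contrapT => Tn.
have Tub i : `[< exists Y : set M, Tdim i Y >] -> (i <= n)%N.
  move=> /asboolP[Y TY]; rewrite leqNgt; apply/negP => ni; apply: Tn.
  by apply: (Tdim_le TY); rewrite (ltnW ni) andbT (leq_trans TX.1 mn).
have Tex : exists i, `[< exists Y : set M, Tdim i Y >].
  by exists m; apply/asboolP; exists X.
have [j /asboolP[Y TY] jmax] := ex_maxnP Tex Tub.
apply: (nT j); split.
  rewrite ltn_neqAle Tub ?andbT; last by apply/asboolP; exists Y.
  by apply/eqP => jn; apply: Tn; exists Y; rewrite -jn.
split; [exact: TY.1|by exists Y|move=> l Z jl TZ _].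
by move: jl; rewrite ltnNge jmax//; apply/asboolP; exists Z.
Qed.


Lemma Twidth_le A m X n : Tdim m X -> (m <= n)%N ->
  (Twidth n A <= deviation A X)%E.
Proof.
move=> TX mn; have [mk [Y TY]] := Twidth_index TX mn.
have [Z TZ XZ] := Tdim_extend TX TY mk.
apply: (@le_trans _ _ (deviation A Z)); first by apply: ereal_inf_lbound; exists Z.
(* Monotonicity of the deviation is the case of error 0. *)
rewrite -[leRHS]adde0; apply: deviation_le_near => // x /XZ Zx.
by exists x; rewrite // mdistxx.
Qed.

Lemma Twidth_near_le A (r : R) : [set: M] !=set0 ->
    (compact_width A < r%:E)%E ->
  \forall n \near \oo, (Twidth n A <= r%:E)%E.
Proof.
move=> M0 /ereal_inf_lt[_ [X cX <-] Xr].
have dfin : deviation A X \is a fin_num.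
  by rewrite ge0_fin_numE ?deviation_ge0// (lt_trans Xr)// ltry.
(* The gap below [r] is the error allowed when approximating [X]. *)
have e0 : 0 < r - fine (deviation A X).
  by rewrite subr_gt0 -lte_fin fineK.
have [m [Y TY XY]] := compact_Tdim_approx M0 cX e0.
exists m => // n /= mn; apply: le_trans (Twidth_le A TY mn) _.
apply: le_trans (deviation_le_near A (ltW e0) XY) _.
by rewrite -{1}(fineK dfin) -EFinD subrKC.
Qed.

End tree.

Theorem theorem2p18 (R : realType) (M : metricType R)
    (M_nonempty : [set: M] !=set0) (M_tree : metric_tree M) (A : set M) :
  Twidth n A @[n --> \oo] --> compact_width A.
Proof.
have : (0 <= compact_width A)%E by exact: width_by_ge0.
have := @Twidth_ge R M M_tree A; have := @Twidth_near_le R M M_tree A ^~ M_nonempty.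
case: (compact_width A) => [c|_|//].
- move=> Tle Tge c0.
  have Tfin : \forall n \near \oo, Twidth n A \is a fin_num.
    have /Tle : (c%:E < (c + 1)%:E)%E by rewrite lte_fin ltrDl.
    apply: filterS => n Tn; rewrite ge0_fin_numE ?width_by_ge0//.
    exact: le_lt_trans Tn (ltry _).
  apply/fine_cvgP; split=> //; apply/cvgrPdist_le => e e0.
  have /Tle : (c%:E < (c + e)%:E)%E by rewrite lte_fin ltrDl.
  apply: filterS2 Tfin => n Tn; have := Tge n.
  rewrite -(fineK Tn) !lee_fin /= => Tc Tce.
  rewrite distrC ger0_norm; lra.
- move=> Tge _.
  (* An infinite compact width bounds every T-width from below. *)
  have -> : Twidth ^~ A = cst +oo%E.
    by apply/funext => n; apply/eqP; rewrite -leye_eq.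
  exact: cvg_cst.
Qed.
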